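(* Let $G$ be a $k$-connected graph on $n$ vertices. Let $P$ and $Q$ be two longest paths in $G$. Then $|V(P)\cap V(Q)| \geq (8k-n+2)/5$.
   Context: All graphs are simple (no loops, no parallel edges). Paths are simple (no repeated vertices or edges). The length of a path is its number of edges, and a longest path in a graph is a path of maximum length among all paths in the graph. $V(P)$ denotes the set of vertices of a path $P$. Two paths are internally disjoint if they have no internal vertices in common. A graph $G$ is $k$-connected if, for any two vertices $u$ and $v$ of $G$, there exists a set of $k$ internally disjoint $u$-$v$ paths.
   Formalization: The bound (8k-n+2)/5 is replaced by min{n, (8k-n+2)/5}, since as stated it fails when it exceeds n: for K_4 with k = 3 all longest paths are Hamiltonian and meet in 4 vertices, but 22/5 > 4. *)

(* Defs.v *)
From mathcomp Require Import all_boot.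

Set Implicit Arguments.
Unset Strict Implicit.
Unset Printing Implicit Defensive.

Definition simple_graph (T : finType) (e : rel T) : Prop :=
  symmetric e /\ irreflexive e.

(* A path is given by its nonempty sequence of pairwise distinct vertices; in a
   simple graph this determines its edges, which are then distinct too. *)
Definition gpath (T : finType) (e : rel T) (s : seq T) : bool :=
  [&& s != [::], uniq s & sorted e s].

Definition gpath_length (T : finType) (s : seq T) : nat := (size s).-1.

Definition gpath_vertices (T : finType) (s : seq T) : {set T} := [set x in s].

Definition longest_gpath (T : finType) (e : rel T) (s : seq T) : Prop :=
  gpath e s /\
  forall s' : seq T, gpath e s' -> gpath_length s' <= gpath_length s.

Definition gpath_between (T : finType) (e : rel T) (u v : T) (s : seq T) : bool :=
  [&& gpath e s, head u s == u & last u s == v].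

Definition internal (T : finType) (s : seq T) : seq T :=
  if s is x :: p then behead (belast x p) else [::].

Definition internally_disjoint (T : finType) (s1 s2 : seq T) : bool :=
  ~~ has (mem (internal s1)) (internal s2).

(* [uniq ps] makes [ps] a set of k distinct paths: without it, the one-edge
   path between adjacent vertices, having no internal vertex, could be
   repeated. *)
Definition k_connected (T : finType) (e : rel T) (k : nat) : Prop :=
  forall u v : T, u != v ->
  exists ps : seq (seq T),
    [/\ uniq ps, size ps = k,
        forall s, s \in ps -> gpath_between e u v s
      & forall s1 s2, s1 \in ps -> s2 \in ps -> s1 != s2 ->
          internally_disjoint s1 s2].

(* Main.v *)
Require Import Defs.
From mathcomp Require Import all_boot all_order all_algebra.
From mathcomp Require Import zify lra.
Import Order.TTheory GRing.Theory Num.Theory.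
Local Open Scope ring_scope.

(** Let L be the common number of vertices of P and Q, and t the number of
    vertices they share; so 2 L <= n + t. If L = n, both paths are Hamiltonian
    and t = n. Otherwise the theorem follows from a lower bound on L.

    Let u be a vertex off Q. The k internally disjoint paths from u to an end q
    of Q, stopped when they first meet Q, form a fan: k paths from u to distinct
    vertices w_i of Q that share only u (none of them first meets Q at q, as Q
    could then be prolonged beyond q). Let l_i be the number of vertices strictly
    between u and w_i on the i-th path. Going from w_i to w_j through u must not
    be longer than following Q, so w_i and w_j are at distance at least
    l_i + l_j + 2 on Q; likewise w_i is at distance at least l_i + 1 from both
    ends of Q. Hence the integer intervals [w_i - l_i, w_i + l_i + 1] of
    positions on Q are pairwise disjoint and avoid the first position, whence
    L >= 1 + 2 k + 2 (l_1 + ... + l_k). Since l_i = 0 forces w_i to be a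
    neighbour of u on Q, this gives
    [longest_gpath_outside_bound]: L >= 2 k + 1 + 2 (k - d), where d is the
    number of neighbours of u on Q.

    If t >= k, any u off Q gives L >= 2 k + 1, and 2 L <= n + t concludes. If
    t < k, let p be an end of P. It has at least k neighbours, all on P, and
    rotating P at a neighbour z yields a longest path with the same vertices
    which ends at the predecessor of z. There are at least k > t such
    predecessors, so one of them, u, is off Q ([rotation_end_outside]). As u is
    an end of a longest path with vertex set V(P), all its neighbours are on P,
    hence d <= t and L >= 4 k - 2 t + 1; again 2 L <= n + t concludes. *)

Section LongestPaths.
Local Open Scope nat_scope.
Set Implicit Arguments.
Unset Strict Implicit.
Unset Printing Implicit Defensive.

(** * Counting disjoint intervals *)

(** Pairwise disjoint intervals of positive integers less than L have total
    length at most L - 1. *)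
Lemma sum_disjoint_intervals (I : finType) (lo len : I -> nat) (L : nat) :
  (forall i, 0 < lo i /\ lo i + len i <= L) ->
  (forall i j, i != j -> lo i + len i <= lo j \/ lo j + len j <= lo i) ->
  \sum_i len i <= L.-1.
Proof.
move=> inL disj.
have lenE i : len i = \sum_(1 <= x < L) (lo i <= x < lo i + len i).
  have [lo_gt0 hiL] := inL i.
  rewrite (big_cat_nat (n := lo i)) //=; last by lia.
  rewrite (big_cat_nat (m := lo i) (n := lo i + len i)) //=; last by lia.
  rewrite big_nat_cond big1; last by move=> x; lia.
  rewrite [X in _ + (_ + X)]big_nat_cond [X in _ + (_ + X)]big1; last by move=> x; lia.
  rewrite big_nat_cond (eq_bigr (fun=> 1)); last by move=> x; lia.
  by rewrite -big_nat_cond sum_nat_const_nat; lia.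
rewrite (eq_bigr _ (fun i _ => lenE i)) exchange_big /=.
rewrite -[L.-1]subn1 -[L - 1]muln1 -sum_nat_const_nat.
apply: leq_sum => x _.
case: (pickP (fun i => lo i <= x < lo i + len i)) => [i xi | none]; last first.
  by rewrite big1 // => i _; rewrite none.
rewrite (bigD1 i) //= xi big1 // => j ji.
by have := disj _ _ ji; lia.
Qed.

Variables (T : finType) (e : rel T).
Hypothesis simpleG : simple_graph e.
Implicit Types (P Q b c : seq T) (u v w x y z : T) (k : nat).

Let symG : symmetric e. Proof. by case: simpleG. Qed.

(** * Longest paths *)

Lemma longest_gpath_size P Q :
  longest_gpath e P -> gpath e Q -> size Q <= size P.
Proof.
move=> [/and3P[P0 _ _] maxP] pQ; have := maxP _ pQ; rewrite /gpath_length.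
by case: P P0 {maxP}; case: Q {pQ}.
Qed.

Lemma longest_gpath_uniq Q : longest_gpath e Q -> uniq Q.
Proof. by case=> /and3P[]. Qed.

Lemma longest_gpath_sorted Q : longest_gpath e Q -> sorted e Q.
Proof. by case=> /and3P[]. Qed.

Lemma longest_gpath_perm P Q :
  longest_gpath e Q -> perm_eq P Q -> sorted e P -> longest_gpath e P.
Proof.
move=> longQ PQ sP; have [/and3P[Q0 uQ _] maxQ] := longQ.
split; last by move=> s /maxQ; rewrite /gpath_length (perm_size PQ).
rewrite /gpath (perm_uniq PQ) uQ sP -size_eq0 (perm_size PQ).
by rewrite size_eq0 Q0.
Qed.

Lemma longest_gpath_rev Q : longest_gpath e Q -> longest_gpath e (rev Q).
Proof.
move=> longQ; apply: (longest_gpath_perm longQ); first by rewrite perm_rev.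
rewrite rev_sorted; have := longest_gpath_sorted longQ.
by congr is_true; apply: eq_sorted => x y; rewrite symG.
Qed.

(** * Paths avoiding a longest path *)

(** Replacing the part of Q before z by a path outside Q does not lengthen Q. *)
Lemma longest_gpath_head_extension Q x b z :
  longest_gpath e Q -> uniq (x :: b) -> path e x b ->
  ~~ has (mem Q) (x :: b) -> z \in Q -> e (last x b) z ->
  size (x :: b) <= index z Q.
Proof.
move=> longQ ub pb bQ zQ ez.
have uQ := longest_gpath_uniq longQ; have sQ := longest_gpath_sorted longQ.
have iL : index z Q < size Q by rewrite index_mem.
have dE : drop (index z Q) Q = z :: drop (index z Q).+1 Q.
  by rewrite (drop_nth z) // nth_index.
suff: gpath e ((x :: b) ++ drop (index z Q) Q).
  by move/(longest_gpath_size longQ); rewrite size_cat size_drop; lia.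
apply/and3P; split=> //.
  rewrite cat_uniq ub drop_uniq // andbT.
  by apply: contra bQ => /hasP[y /mem_drop yQ yb]; apply/hasP; exists y.
have := drop_sorted (index z Q) sQ.
by rewrite dE /= cat_path pb /= ez.
Qed.

Lemma longest_gpath_last_extension Q x b z :
  longest_gpath e Q -> uniq (x :: b) -> path e x b ->
  ~~ has (mem Q) (x :: b) -> z \in Q -> e (last x b) z ->
  size (x :: b) + index z Q < size Q.
Proof.
move=> longQ ub pb bQ zQ ez.
have uQ := longest_gpath_uniq longQ.
have iL : index z Q < size Q by rewrite index_mem.
have bR : ~~ has (mem (rev Q)) (x :: b).
  apply: contra bQ => /hasP[y yb yQ]; apply/hasP.
  by exists y => //=; rewrite -mem_rev.
have zR : z \in rev Q by rewrite mem_rev.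
have := longest_gpath_head_extension (longest_gpath_rev longQ) ub pb bR zR ez.
have -> : index z (rev Q) = size Q - (index z Q).+1.
  rewrite -[z in LHS](_ : nth z (rev Q) (size Q - (index z Q).+1) = z).
    by rewrite index_uniq ?rev_uniq // size_rev ltn_subrL (leq_ltn_trans _ iL).
  by rewrite nth_rev ?subnSK ?subKn ?nth_index //; lia.
by lia.
Qed.

(** Replacing the part of Q strictly between z and z' by a path outside Q does
    not lengthen Q. *)
Lemma longest_gpath_detour Q z x b z' :
  longest_gpath e Q -> uniq (x :: b) -> path e x b ->
  ~~ has (mem Q) (x :: b) -> z \in Q -> z' \in Q ->
  e z x -> e (last x b) z' -> index z Q < index z' Q ->
  index z Q + size (x :: b) < index z' Q.
Proof.
move=> longQ ub pb bQ zQ z'Q ezx ez' ij.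
have uQ := longest_gpath_uniq longQ; have sQ := longest_gpath_sorted longQ.
have jL : index z' Q < size Q by rewrite index_mem.
have dE : drop (index z' Q) Q = z' :: drop (index z' Q).+1 Q.
  by rewrite (drop_nth z') // nth_index.
have tE : take (index z Q).+1 Q = rcons (take (index z Q) Q) z.
  by rewrite (take_nth z) ?nth_index // index_mem.
suff: gpath e (take (index z Q).+1 Q ++ (x :: b) ++ drop (index z' Q) Q).
  move/(longest_gpath_size longQ); rewrite !size_cat size_drop size_takel; lia.
have bdis (R : seq T) : {subset R <= Q} -> ~~ has (mem (x :: b)) R.
  move=> RQ; apply: contra bQ => /hasP[y /RQ yQ yb]; apply/hasP; by exists y.
have nbQ (R : seq T) : {subset R <= Q} -> ~~ has (mem R) (x :: b).
  by rewrite -has_sym; apply: bdis.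
apply/and3P; split.
- by rewrite tE; case: (take _ _).
- rewrite !cat_uniq take_uniq // ub drop_uniq // !andbT has_cat negb_or.
  rewrite nbQ ?bdis ?andbT /=; [|by move=> y /mem_drop|by move=> y /mem_take].
  apply/hasPn => y yd; apply/negP => /= yt.
  have yd' : y \in drop (index z Q).+1 Q.
    by move: yd; rewrite -(subnK ij) -drop_drop => /mem_drop.
  move: uQ; rewrite -(cat_take_drop (index z Q).+1 Q) cat_uniq.
  by case/and3P=> _ /hasPn/(_ y yd') /=; rewrite yt.
- have st := take_sorted (index z Q).+1 sQ.
  have sd := drop_sorted (index z' Q) sQ.
  rewrite dE /= in sd *; rewrite tE in st *.
  case: (take _ _) st => [|a l] /=; first by rewrite ezx cat_path pb /= ez' sd.
  by rewrite cat_path last_rcons => -> /=; rewrite ezx cat_path pb /= ez' sd.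
Qed.

(** * Rotations *)

(** If the end p of P is adjacent to z, then reversing the part of P before z
    turns the predecessor of z into an end. *)
Lemma longest_gpath_rotation P p r z :
  P = p :: r -> longest_gpath e P -> z \in r -> e p z ->
  longest_gpath e (rev (take (index z P) P) ++ drop (index z P) P).
Proof.
move=> PE longP zr epz; have zP : z \in P by rewrite PE inE zr orbT.
have sP := longest_gpath_sorted longP.
apply: (longest_gpath_perm longP).
  by rewrite -[X in perm_eq _ X](cat_take_drop (index z P)) perm_cat2r perm_rev.
have uP := longest_gpath_uniq longP.
have zp : p != z by apply: contraL zr => /eqP <-; move: uP; rewrite PE => /andP[].
have dE : drop (index z P) P = z :: drop (index z P).+1 P.
  by rewrite (drop_nth z) ?index_mem // nth_index.
have tE : take (index z P) P = p :: take (index z r) r.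
  by rewrite PE /= (negbTE zp).
have sd := drop_sorted (index z P) sP.
have st : sorted e (rev (take (index z P) P)).
  rewrite rev_sorted (eq_sorted (e' := e)); first exact: take_sorted.
  by move=> x y; rewrite symG.
move: st; rewrite tE rev_cons dE in sd *.
case: (rev _) => [|a l] /=; first by rewrite epz.
by rewrite cat_path last_rcons => -> /=; rewrite epz.
Qed.

Lemma longest_gpath_head_neighbour P p r z :
  P = p :: r -> longest_gpath e P -> e p z -> z \in P.
Proof.
move=> PE longP epz; apply/negPn/negP => zP.
have := @longest_gpath_head_extension P z [::] p longP isT isT.
by rewrite /= orbF zP PE mem_head /= eqxx symG epz => /(_ isT isT isT).
Qed.

(** * Fans in k-connected graphs *)

(** The k paths of the definition of k-connectivity, given by their sequences
    [c i] of internal vertices. *)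
Lemma k_connected_interiors k u v : k_connected e k -> u != v ->
  exists c : 'I_k -> seq T,
    [/\ injective c, forall i, uniq (u :: rcons (c i) v),
        forall i, path e u (rcons (c i) v)
      & forall i j x, x \in c i -> x \in c j -> i = j].
Proof.
move=> connG uv; have [ps [ups szps betw disj]] := connG _ _ uv.
have psE s : s \in ps -> s = u :: rcons (internal s) v.
  move/betw => /and3P[/and3P[]]; case: s => //= x s _ _ _ /eqP-> .
  case/lastP: s => [|s y]; first by rewrite /= (negbTE uv).
  by rewrite last_rcons belast_rcons => /eqP->.
have inps (i : 'I_k) : nth [::] ps i \in ps by rewrite mem_nth // szps.
have nth_inj (i j : 'I_k) : nth [::] ps i = nth [::] ps j -> i = j.
  by move/eqP; rewrite nth_uniq ?szps // => /eqP/val_inj.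
exists (fun i => internal (nth [::] ps i)); split.
- by move=> i j /= ij; apply: nth_inj; rewrite (psE _ (inps i)) ij -psE.
- move=> i; rewrite -psE //; by have /and3P[/and3P[]] := betw _ (inps i).
- move=> i; have := betw _ (inps i); rewrite {1}(psE _ (inps i)).
  by case/and3P=> /and3P[].
- move=> i j x xi xj; apply: nth_inj; apply/eqP/negPn/negP => ij.
  by have /hasPn/(_ x xj)/negP := disj _ _ (inps i) (inps j) ij; apply.
Qed.

Lemma k_connected_degree k u v :
  k_connected e k -> u != v -> k <= #|[set z | e u z]|.
Proof.
move=> connG uv; have [c [cI uc pc dc]] := k_connected_interiors connG uv.
have hI : injective (fun i => head v (c i)).
  move=> i j /= hij; have vc l : v \notin c l.
    by have := uc l; rewrite /= rcons_uniq => /and3P[].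
  move: hij (vc i) (vc j) (cI i j) (dc i j).
  case: (c i) => [|x s]; case: (c j) => [|y s'] /=.
  - by move=> _ _ _ /(_ erefl).
  - by move=> -> _; rewrite mem_head.
  - by move=> ->; rewrite mem_head.
  - by move=> -> _ _ _ dij; apply: (dij y); rewrite mem_head.
rewrite -[k]card_ord -(card_codom hI); apply: subset_leq_card.
apply/subsetP => x /codomP[i ->]; rewrite inE.
by have := pc i; case: (c i) => [|y s] /= /andP[].
Qed.

(** A vertex u off a longest path Q is joined to k distinct vertices [w i] of Q
    by paths that meet only in u, and meet Q only in [w i]; [a i] lists the
    vertices strictly between u and [w i]. *)
Lemma k_connected_fan k Q u :
  k_connected e k -> longest_gpath e Q -> u \notin Q ->
  exists (a : 'I_k -> seq T) (w : 'I_k -> T),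
    [/\ injective w,
        forall i, w i \in Q /\ path e u (rcons (a i) (w i)),
        forall i, uniq (u :: a i) /\ ~~ has (mem Q) (u :: a i)
      & forall i j x, x \in a i -> x \in a j -> i = j].
Proof.
move=> connG longQ uQ.
have [q [r QE]] : exists q r, Q = q :: r.
  by case: longQ => /and3P[]; case: (Q) => // q r _ _ _ _; exists q, r.
have qQ : q \in Q by rewrite QE mem_head.
have uq : u != q by apply: contraNneq uQ => ->.
have [c [cI uc pc dc]] := k_connected_interiors connG uq.
(* Each path meets Q before its last vertex q, the head of Q; otherwise it
   would prolong Q. *)
have hc i : has (mem Q) (c i).
  apply/negPn/negP => ncQ.
  have := uc i; rewrite -rcons_cons rcons_uniq => /andP[_ uuc].
  have := pc i; rewrite rcons_path => /andP[puc euq].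
  have := longest_gpath_head_extension longQ uuc puc _ qQ euq.
  by rewrite /= negb_or uQ ncQ QE /= eqxx => /(_ isT).
pose f i := find (mem Q) (c i).
have cE i : c i = rcons (take (f i) (c i)) (nth u (c i) (f i))
                    ++ drop (f i).+1 (c i).
  by rewrite -take_nth -?has_find // cat_take_drop.
have wc i : nth u (c i) (f i) \in c i by rewrite mem_nth // -has_find.
exists (fun i => take (f i) (c i)), (fun i => nth u (c i) (f i)); split.
- by move=> i j /= wij; apply: (dc i j _ (wc i)); rewrite wij wc.
- move=> i; split; first exact: (nth_find u (hc i)).
  by have := pc i; rewrite {1}cE rcons_cat cat_path => /andP[].
- move=> i; split.
    have := uc i; rewrite -rcons_cons rcons_uniq => /andP[_].
    by move/(take_uniq (f i).+1).
  rewrite /= negb_or uQ /=; apply/negP => /(has_nthP u)[j].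
  rewrite size_takel ?find_size // => jf.
  by rewrite nth_take // (before_find u jf).
- by move=> i j x /mem_take xi /mem_take xj; apply: dc xi xj.
Qed.

(** * The length of a longest path *)

Lemma longest_gpath_outside_bound k Q u :
  k_connected e k -> longest_gpath e Q -> u \notin Q ->
  2 * k + 1 + 2 * (k - #|[set z in Q | e u z]|) <= size Q.
Proof.
move=> connG longQ uQ.
have [a [w [wI wP aP disj]]] := k_connected_fan connG longQ uQ.
pose l i := size (a i).
have Qgt0 : 0 < size Q by case: longQ => /and3P[]; case: (Q).
have ends i : l i < index (w i) Q /\ index (w i) Q + l i + 1 < size Q.
  have [wQ] := wP i; rewrite rcons_path => /andP[pa ea].
  have [ua aQ] := aP i.
  have := longest_gpath_head_extension longQ ua pa aQ wQ ea.
  have := longest_gpath_last_extension longQ ua pa aQ wQ ea.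
  by rewrite /= -/(l i); lia.
have apart i j : index (w i) Q < index (w j) Q ->
    index (w i) Q + l i + l j + 1 < index (w j) Q.
  move=> ij; have ji : j != i by apply: contraTneq ij => ->; rewrite ltnn.
  have [wiQ] := wP i; rewrite rcons_path => /andP[pi ei].
  have [wjQ] := wP j; rewrite rcons_path => /andP[pj ej].
  have [/= /andP[ui uai] /norP[_ iQ]] := aP i.
  have [/= /andP[uj uaj] /norP[_ jQ]] := aP j.
  (* The detour runs back along [a i] to u, then along [a j]. *)
  have pathE : last u (a i) :: rev (belast u (a i)) ++ a j = rev (u :: a i) ++ a j.
    by rewrite [u :: a i]lastI rev_rcons.
  have lastE : last (last u (a i)) (rev (belast u (a i))) = u.
    by case: (a i) => //= y s; rewrite rev_cons last_rcons.
  have := @longest_gpath_detour Q (w i) (last u (a i))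
    (rev (belast u (a i)) ++ a j) (w j) longQ.
  rewrite pathE last_cat lastE cat_path lastE pj andbT size_cat size_rev /=.
  have -> : uniq (rev (u :: a i) ++ a j).
    rewrite cat_uniq rev_uniq /= ui uai uaj !andbT; apply/hasPn => y yj.
    rewrite /= mem_rev inE negb_or (contraNneq _ uj) => [|<- //].
    by apply: contra ji => yi; apply/eqP/(disj _ _ y).
  have -> : path e (last u (a i)) (rev (belast u (a i))).
    by rewrite rev_path (eq_path (e' := e)) // => x y; rewrite symG.
  have -> : ~~ has (mem Q) (rev (u :: a i) ++ a j).
    by rewrite has_cat has_rev /= !negb_or uQ iQ.
  rewrite symG ei ej => /(_ isT isT isT wiQ wjQ isT isT ij).
  by rewrite addSn addnS addnA addn1.
(* On positions of Q, the intervals [w - l, w + l + 1] are disjoint. *)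
have wsum : \sum_i (2 * l i + 2) <= (size Q).-1.
  apply: (@sum_disjoint_intervals _ (fun i => index (w i) Q - l i)).
    by move=> i; have := ends i; lia.
  move=> i j ij; have := apart i j; have := apart j i.
  have := ends i; have := ends j.
  have : index (w i) Q != index (w j) Q.
    apply: contraNneq ij => ij; apply/eqP/wI.
    by rewrite -(nth_index u (wP i).1) ij nth_index // (wP j).1.
  lia.
have zero : #|[set i | l i == 0]| <= #|[set z in Q | e u z]|.
  rewrite -(card_imset _ wI); apply: subset_leq_card; apply/subsetP => z.
  case/imsetP=> i; rewrite !inE size_eq0 => /eqP ai ->.
  by have [-> ] := wP i; rewrite ai /= andbT => ->.
have lsum : k - #|[set i | l i == 0]| <= \sum_i l i.
  rewrite leq_subLR -sum1dep_card -[X in X <= _]card_ord -sum1_card.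
  rewrite (bigID (fun i => l i == 0)) /= leq_add2l.
  rewrite [X in _ <= X](bigID (fun i => l i == 0)) /=.
  apply: leq_trans (leq_addl _ _); apply: leq_sum => i; lia.
move: wsum; rewrite big_split /= -big_distrr /= sum_nat_const card_ord.
have := leq_trans (leq_sub2l k zero) lsum; move: Qgt0; clear.
move: (size Q) (\sum_i l i) #|_| => L S d; lia.
Qed.

(** * Two longest paths *)

(** The vertex u found here is the end of a rotation of P, which is why all its
    neighbours lie on P. *)
Lemma rotation_end_outside k P Q p r v :
  k_connected e k -> longest_gpath e P -> P = p :: r -> p != v ->
  #|gpath_vertices P :&: gpath_vertices Q| < k ->
  exists2 u, u \in P /\ u \notin Q & forall z, e u z -> z \in P.
Proof.
move=> connG longP PE pv ltk.
have uP := longest_gpath_uniq longP.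
(* [f] maps a neighbour of p to its predecessor on P. *)
pose f z := nth p P (index z P).-1.
have Nr z : e p z -> z \in r.
  move=> epz; have := longest_gpath_head_neighbour PE longP epz.
  rewrite PE inE => /predU1P[zp|//].
  by case: simpleG => _ irr; rewrite zp irr in epz.
have Ni z : e p z -> 0 < index z P < size P.
  move=> /Nr zr; rewrite index_mem PE inE zr orbT andbT /=.
  by case: eqP => // pz; move: uP; rewrite PE pz /= zr.
have fI : {in [set z | e p z] &, injective f}.
  move=> y z; rewrite !inE => py pz /eqP; have := Ni _ py; have := Ni _ pz.
  move=> /andP[z0 zP] /andP[y0 yP].
  rewrite nth_uniq ?(leq_ltn_trans (leq_pred _)) // => /eqP yz.
  apply: (index_inj p (s := P)); rewrite -?index_mem //.
  by rewrite -(prednK y0) yz prednK.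
have /subsetPn[u] : ~~ (f @: [set z | e p z]
                         \subset gpath_vertices P :&: gpath_vertices Q).
  apply/negP => /subset_leq_card; rewrite card_in_imset // leqNgt.
  by rewrite (leq_trans ltk) ?(k_connected_degree connG pv).
case/imsetP=> z; rewrite inE => pz uE; have /andP[z0 zP] := Ni _ pz.
have fP : u \in P by rewrite uE mem_nth // (leq_ltn_trans (leq_pred _)).
rewrite !inE fP /= => fQ; exists u => // y uy.
have longR := longest_gpath_rotation PE longP (Nr _ pz) pz.
move: (longR); rewrite -(prednK z0) (take_nth p) ?(leq_ltn_trans (leq_pred _)) //.
rewrite prednK // rev_rcons -/(f z) -uE cat_cons => longR'.
have := longest_gpath_head_neighbour (erefl _) longR' uy.
rewrite inE mem_cat mem_rev => /or3P[/eqP->//|/mem_take//|/mem_drop//].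
Qed.

Lemma longest_gpaths_size P Q :
  longest_gpath e P -> longest_gpath e Q -> size P = size Q.
Proof.
move=> longP longQ; have [[pP _] [pQ _]] := (longP, longQ).
by apply/eqP; rewrite eqn_leq !longest_gpath_size.
Qed.

Lemma card_gpath_vertices P : longest_gpath e P -> #|gpath_vertices P| = size P.
Proof. by move/longest_gpath_uniq/card_uniqP <-; rewrite cardsE. Qed.

Lemma longest_gpaths_meet k P Q :
  k_connected e k -> longest_gpath e P -> longest_gpath e Q ->
  let t := #|gpath_vertices P :&: gpath_vertices Q| in
  #|T| <= t \/ 8 * k + 2 <= 5 * t + #|T|.
Proof.
move=> connG longP longQ t.
have szPQ := longest_gpaths_size longP longQ.
have cP := card_gpath_vertices longP; have cQ := card_gpath_vertices longQ.
have union : size P + size Q <= #|T| + t.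
  rewrite -cP -cQ -cardsUI leq_add2r; exact: max_card.
case: (pickP (fun u => u \notin Q)) => [u uQ | allQ]; last first.
  left; suff szT : #|T| <= size Q by lia.
  rewrite -cQ subset_leq_card //; apply/subsetP => x _.
  by rewrite inE; apply/negPn; rewrite allQ.
right; have bound := longest_gpath_outside_bound connG longQ.
have [kt | tk] := leqP k t; first by have := bound _ uQ; lia.
have [p [r PE]] : exists p r, P = p :: r.
  by case: longP => /and3P[]; case: (P) => // p r _ _ _ _; exists p, r.
have [v pv] : exists v, p != v.
  apply/existsP; apply: contraTT isT => /existsPn eqp.
  move: uQ; have /eqP <- := negbNE (eqp u).
  have [/and3P[]] := longQ; case: (Q) => // q s _ _ _ _.
  by have /eqP <- := negbNE (eqp q); rewrite mem_head.
have [y [yP yQ] Ny] := rotation_end_outside connG longP PE pv tk.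
have : #|[set z in Q | e y z]| <= t.
  apply/subset_leq_card/subsetP => z; rewrite !inE => /andP[-> /Ny ->] //.
by have := bound _ yQ; lia.
Qed.

End LongestPaths.

(* The bound is capped at n because (8k-n+2)/5 exceeds n when 4k >= 3n, as for
   the complete graph on 4 vertices with k = 3. *)
Theorem theorem3p4 (T : finType) (e : rel T) (k n : nat) (P Q : seq T)
  (simpleG : simple_graph e) (orderG : #|T| = n) (connG : k_connected e k)
  (longP : longest_gpath e P) (longQ : longest_gpath e Q) :
  Num.min (n%:R : rat) ((8 * k%:R - n%:R + 2) / 5)
    <= #|gpath_vertices P :&: gpath_vertices Q|%:R.
Proof.
rewrite ge_min -orderG; apply/orP.
have [nt | bound] := longest_gpaths_meet simpleG connG longP longQ.
  by left; rewrite ler_nat.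
right; move: bound; rewrite -(ler_nat rat) natrD [leRHS]natrD !natrM => bound.
by lra.
Qed.
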